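(* Let $A$ be a $d$-dimensional $k_1$-stochastic matrix of order $n_1$ and let $B$ be a $d$-dimensional $k_2$-stochastic matrix of order $n_2$. Put $r = \max\{k_1,k_2\}$. Then $n_1^{k_1 - r}\, n_2^{k_2 - r}\,(A\otimes B)$ is a $d$-dimensional $r$-stochastic matrix, where $A\otimes B$ denotes the Kronecker product. In particular, the Kronecker product of polystochastic matrices (of the same dimension) is polystochastic.
   Context: Let $I_n^d = \{1,\ldots,n\}^d$ with $n,d$ positive integers. A $d$-dimensional matrix $A$ of order $n$ is an array $(a_\alpha)_{\alpha\in I_n^d}$ of real numbers. For $k\in\{0,\ldots,d\}$, a $k$-dimensional plane in $A$ is a submatrix obtained by fixing some $d-k$ components of the indices and letting the other $k$ components vary from $1$ to $n$. For $k\in\{0,\ldots,d\}$, $A$ is $k$-stochastic if all its entries are nonnegative and the sum of entries in each $k$-dimensional plane equals $1$. A $1$-stochastic matrix is called polystochastic. The Kronecker product $A\otimes B$ of a $d$-dimensional matrix $A$ of order $n_1$ and a $d$-dimensional matrix $B$ of order $n_2$ is the $d$-dimensional matrix $C$ of order $n_1n_2$ with entries $c_\gamma = a_\alpha b_\beta$, where $\gamma_i = (\alpha_i-1)n_2+\beta_i$ for each $i=1,\ldots,d$. *)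

(* Defs.v *)
From mathcomp Require Import all_boot all_order all_algebra.
From mathcomp Require Import reals.

Set Implicit Arguments.
Unset Strict Implicit.
Unset Printing Implicit Defensive.

Import Order.TTheory GRing.Theory Num.Theory.

Local Open Scope ring_scope.

(* Coordinates are numbered from 0 and index values run over 0, ..., n - 1. *)
Definition mdindex (d n : nat) := {ffun 'I_d -> 'I_n}.

Definition mdmatrix (R : Type) (d n : nat) := {ffun mdindex d n -> R}.

(* F is the set of fixed components, x supplies the values they are fixed to. *)
Definition plane d n (F : {set 'I_d}) (x : mdindex d n) : {set mdindex d n} :=
  [set a : mdindex d n | [forall i in F, a i == x i]].

(* [#|F| + k = d] says that d - k components are fixed, avoiding truncated
   subtraction. *)
Definition is_plane d n (k : nat) (P : {set mdindex d n}) : Prop :=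
  exists (F : {set 'I_d}) (x : mdindex d n), (#|F| + k = d)%N /\ P = plane F x.

(* Only meaningful for k <= d: for k > d there is no k-dimensional plane. *)
Definition stochastic (R : realType) d n (k : nat) (A : mdmatrix R d n) : Prop :=
  (forall a, 0 <= A a) /\
  (forall P : {set mdindex d n}, is_plane k P -> \sum_(a in P) A a = 1).

Definition polystochastic (R : realType) d n (A : mdmatrix R d n) : Prop :=
  stochastic 1 A.

Definition mdscale (R : realType) d n (c : R) (A : mdmatrix R d n) :
  mdmatrix R d n := [ffun a => c * A a].

Lemma kron_div_subproof n1 n2 (g : 'I_(n1 * n2)) : (g %/ n2 < n1)%N.
Proof.
case: n2 g => [|n2] g; last by rewrite ltn_divLR.
by case: g => m; rewrite muln0.
Qed.

Lemma kron_mod_subproof n1 n2 (g : 'I_(n1 * n2)) : (g %% n2 < n2)%N.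
Proof.
case: n2 g => [|n2] g; last by rewrite ltn_mod.
by case: g => m; rewrite muln0.
Qed.

Definition kron_div n1 n2 (g : 'I_(n1 * n2)) : 'I_n1 :=
  Ordinal (kron_div_subproof g).

Definition kron_mod n1 n2 (g : 'I_(n1 * n2)) : 'I_n2 :=
  Ordinal (kron_mod_subproof g).

(* With 1-based indices the defining relation is
   g_i = (a_i - 1) * n2 + b_i; shifted to 0-based ones it reads
   g_i = a_i * n2 + b_i, so a_i and b_i are the quotient and the remainder of
   g_i by n2 (see kronE). *)
Definition kron (R : realType) d n1 n2
    (A : mdmatrix R d n1) (B : mdmatrix R d n2) : mdmatrix R d (n1 * n2) :=
  [ffun g : mdindex d (n1 * n2) =>
     A [ffun i => kron_div (g i)] * B [ffun i => kron_mod (g i)]].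

Lemma kronE (R : realType) d n1 n2 (A : mdmatrix R d n1) (B : mdmatrix R d n2)
    (a : mdindex d n1) (b : mdindex d n2) (g : mdindex d (n1 * n2)) :
  (forall i, g i = a i * n2 + b i :> nat)%N -> kron A B g = A a * B b.
Proof.
move=> gE; rewrite ffunE; congr (A _ * B _); apply/ffunP => i; rewrite ffunE;
  apply: val_inj; rewrite /= gE.
- by rewrite divnMDl ?divn_small ?addn0 // (leq_ltn_trans _ (ltn_ord (b i))).
- by rewrite modnMDl modn_small.
Qed.

(* Main.v *)
Require Import Defs.
From mathcomp Require Import all_boot all_order all_algebra.
From mathcomp Require Import reals.

Set Implicit Arguments.
Unset Strict Implicit.
Unset Printing Implicit Defensive.

Import Order.TTheory GRing.Theory Num.Theory.

Local Open Scope ring_scope.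

(** The proof rests on two facts.

    Multiplicities: a (k+1)-dimensional plane is cut into n parallel
    k-dimensional planes by letting one of its free coordinates take each of
    its n values.  Hence, if every k-plane of a matrix has sum 1, every r-plane
    with k <= r has sum n ^ (r - k) ([sum_plane_stochastic]).

    Multiplicativity: writing each coordinate of an index of order n1 * n2 as
    a quotient and a remainder by n2 is a bijection onto pairs of indices, and
    it turns a plane into the product of two planes with the same set of fixed
    coordinates.  So the sum of A (x) B over a plane is the product of a
    plane sum of A and a plane sum of B ([sum_plane_kron]).

    For planes of dimension r = max k1 k2 this product is
    n1 ^ (r - k1) * n2 ^ (r - k2), and the scaling factor is its inverse.  For
    polystochastic matrices k1 = k2 = r = 1, and that factor is 1. *)

(** * Sums over planes of larger dimension *)

Definition set_coord d n (x : mdindex d n) (j : 'I_d) (v : 'I_n) :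
  mdindex d n := [ffun i => if i == j then v else x i].

Lemma in_plane_set_coord d n (F : {set 'I_d}) (x a : mdindex d n) j v :
  j \notin F ->
  (a \in plane (j |: F) (set_coord x j v)) = (a \in plane F x) && (a j == v).
Proof.
move=> jF; rewrite !inE; apply/forall_inP/andP => [aP|[/forall_inP aF /eqP aj] i].
  split; last by move: (aP j (setU11 _ _)); rewrite ffunE eqxx.
  apply/forall_inP => i iF; move: (aP i (setU1r _ iF)); rewrite ffunE.
  by rewrite ifN //; apply: contraNneq jF => <-.
by rewrite in_setU1 ffunE; case: eqP => [-> _|_ /aF//]; rewrite aj.
Qed.

Lemma sum_plane_slice (R : pzSemiRingType) d n (A : mdmatrix R d n)
    (F : {set 'I_d}) (x : mdindex d n) j :
  j \notin F ->
  \sum_(a in plane F x) A a =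
  \sum_(v < n) \sum_(a in plane (j |: F) (set_coord x j v)) A a.
Proof.
move=> jF; rewrite (partition_big (fun a : mdindex d n => a j) predT) //=.
apply: eq_bigr => v _; apply: eq_bigl => a.
by rewrite in_plane_set_coord.
Qed.

(** A plane of dimension k + m has m more free coordinates than a k-plane;
    fixing them in all possible ways cuts it into n ^ m planes of dimension
    k. *)
Lemma sum_plane_addn (R : pzSemiRingType) d n (A : mdmatrix R d n) k s :
  (forall P, is_plane k P -> \sum_(a in P) A a = s) ->
  forall m P, is_plane (k + m) P -> \sum_(a in P) A a = s *+ n ^ m.
Proof.
move=> sumA; elim=> [|m IHm] P; first by rewrite addn0 => /sumA.
move=> [F [x [cardF ->]]].
have [j jF] : exists j, j \notin F.
  apply/existsP; rewrite -negb_forall; apply/negP => /forallP allF.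
  (* If F were everything, the plane would have dimension 0, not k + m + 1. *)
  have FT : F = setT by apply/setP => i; rewrite in_setT allF.
  move/eqP: cardF; rewrite FT cardsT card_ord.
  by rewrite -[X in _ == X]addn0 eqn_add2l addnS.
rewrite (sum_plane_slice _ _ jF).
under eq_bigr => v _.
  rewrite IHm; last first.
    exists (j |: F), (set_coord x j v); split=> //.
    by rewrite cardsU1 jF add1n addSnnS -addnS.
  over.
by rewrite sumr_const card_ord -mulrnA -expnSr.
Qed.

Lemma sum_plane_stochastic (R : realType) d n k r (A : mdmatrix R d n)
    (P : {set mdindex d n}) :
  stochastic k A -> (k <= r)%N -> is_plane r P ->
  \sum_(a in P) A a = n%:R ^+ (r - k).
Proof.
by move=> [_ sumA] kr rP; rewrite -natrX (sum_plane_addn sumA (m := r - k)) ?subnKC.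
Qed.

(** * Sums of a Kronecker product over planes *)

Definition mdindex_split d n1 n2 (g : mdindex d (n1 * n2)) :
    mdindex d n1 * mdindex d n2 :=
  ([ffun i => kron_div (g i)], [ffun i => kron_mod (g i)]).

Lemma kron_divmod_eq n1 n2 (g h : 'I_(n1 * n2)) :
  (g == h) = (kron_div g == kron_div h) && (kron_mod g == kron_mod h).
Proof.
apply/eqP/andP => [->|[/eqP/(congr1 val)/= eq_div /eqP/(congr1 val)/= eq_mod]].
  by rewrite !eqxx.
by apply: val_inj; rewrite /= (divn_eq g n2) (divn_eq h n2) eq_div eq_mod.
Qed.

(** Quotient and remainder determine each coordinate, and both sides have
    (n1 * n2) ^ d elements. *)
Lemma mdindex_split_bij d n1 n2 : bijective (@mdindex_split d n1 n2).
Proof.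
apply: inj_card_bij => [g h [/ffunP eq_div /ffunP eq_mod]|].
  apply/ffunP => i; apply/eqP; rewrite kron_divmod_eq.
  by move: (eq_div i) (eq_mod i); rewrite !ffunE => -> ->; rewrite !eqxx.
by rewrite card_prod !card_ffun !card_ord expnMn.
Qed.

Lemma in_plane_split d n1 n2 (F : {set 'I_d}) (x g : mdindex d (n1 * n2)) :
  (g \in plane F x) =
  ((mdindex_split g).1 \in plane F (mdindex_split x).1)
  && ((mdindex_split g).2 \in plane F (mdindex_split x).2).
Proof.
rewrite !inE; apply/forall_inP/andP => [gx|[/forall_inP gx1 /forall_inP gx2] i iF].
  by split; apply/forall_inP => i /gx/eqP gxi; rewrite !ffunE gxi.
by move: (gx1 i iF) (gx2 i iF); rewrite !ffunE kron_divmod_eq => -> ->.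
Qed.

Lemma sum_plane_kron (R : realType) d n1 n2
    (A : mdmatrix R d n1) (B : mdmatrix R d n2)
    (F : {set 'I_d}) (x : mdindex d (n1 * n2)) :
  \sum_(g in plane F x) kron A B g =
  (\sum_(a in plane F (mdindex_split x).1) A a) *
  (\sum_(b in plane F (mdindex_split x).2) B b).
Proof.
rewrite big_distrlr pair_big /=.
rewrite (reindex _ (onW_bij _ (@mdindex_split_bij d n1 n2))) /=.
apply: eq_big => [g|g _]; first exact: in_plane_split.
by rewrite ffunE.
Qed.

(** * Stochasticity of the Kronecker product *)

Lemma exprz_subn_mulV (F : fieldType) (c : F) k r :
  c != 0 -> (k <= r)%N -> c ^ (k%:Z - r%:Z) * c ^+ (r - k) = 1.
Proof.
move=> c0 kr; rewrite exprnP -expfzDr // -subzn //.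
by rewrite subrKA subrr expr0z.
Qed.

Theorem theorem2 (R : realType) (d n1 n2 : nat)
    (d_gt0 : (0 < d)%N) (n1_gt0 : (0 < n1)%N) (n2_gt0 : (0 < n2)%N)
    (A : mdmatrix R d n1) (B : mdmatrix R d n2) :
  (forall k1 k2 : nat, (k1 <= d)%N -> (k2 <= d)%N ->
     stochastic k1 A -> stochastic k2 B ->
     let r := maxn k1 k2 in
     stochastic r
       (mdscale ((n1%:R : R) ^ (k1%:Z - r%:Z) * (n2%:R : R) ^ (k2%:Z - r%:Z))
          (kron A B)))
  /\ (polystochastic A -> polystochastic B -> polystochastic (kron A B)).
Proof.
have kron_stochastic k1 k2 : stochastic k1 A -> stochastic k2 B ->
    let r := maxn k1 k2 in
    stochastic r
      (mdscale ((n1%:R : R) ^ (k1%:Z - r%:Z) * (n2%:R : R) ^ (k2%:Z - r%:Z))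
         (kron A B)).
  move=> stA stB r; split=> [g|P [F [x [cardF ->]]]].
    rewrite !ffunE !mulr_ge0 ?exprz_ge0 ?ler0n //; first exact: stA.1.
    exact: stB.1.
  under eq_bigr => g _ do rewrite ffunE.
  rewrite -mulr_sumr sum_plane_kron.
  rewrite (sum_plane_stochastic (r := r) stA) ?leq_maxl //; last first.
    by exists F, (mdindex_split x).1.
  rewrite (sum_plane_stochastic (r := r) stB) ?leq_maxr //; last first.
    by exists F, (mdindex_split x).2.
  rewrite mulrACA !exprz_subn_mulV ?mulr1 ?leq_maxl ?leq_maxr //.
    by rewrite pnatr_eq0 -lt0n.
  by rewrite pnatr_eq0 -lt0n.
split=> [k1 k2 _ _|stA stB]; first exact: kron_stochastic.
have /= := kron_stochastic 1%N 1%N stA stB.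
rewrite maxnn subrr !expr0z mulr1.
suff -> : mdscale 1 (kron A B) = kron A B by [].
by apply/ffunP => g; rewrite ffunE mul1r.
Qed.
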